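(* Any set $A\subset\mathbb{R}^n$ ($n\ge 2$) with Hausdorff dimension greater than $1$ contains angles arbitrarily close to the right angle. Thus $\widetilde{C}(90^\circ,\delta)=1$ for any $\delta>0$.
   Context: A set $A\subset\mathbb{R}^n$ contains the angle $\alpha\in[0,180^\circ]$ if there exist distinct points $x,y,z\in A$ such that the angle between the vectors $y-x$ and $z-x$ is $\alpha$. Let $\dim$ denote Hausdorff dimension. For $\alpha\in[0,180^\circ]$ and $\delta>0$ define $$\widetilde{C}(\alpha,\delta)=\sup\{\dim(A) : A\subset\mathbb{R}^n \text{ for some } n;\ A \text{ does not contain any angle from } (\alpha-\delta,\alpha+\delta)\},$$ where $A$ is an arbitrary set and $n$ is not fixed.
   Formalization: The second claim is proved for 0 < δ ≤ 90° rather than for any δ > 0: for δ > 90° the interval contains every angle in [0°,180°], so an avoiding set has at most two points and C̃(90°,δ) = 0. *)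

(* Defs.v *)
From HB Require Import structures.
From mathcomp Require Import all_boot all_order all_algebra.
From mathcomp Require Import all_classical all_reals all_analysis.
Set Implicit Arguments.
Unset Strict Implicit.
Unset Printing Implicit Defensive.
Import Order.TTheory GRing.Theory Num.Theory.
Import numFieldNormedType.Exports.
Local Open Scope classical_set_scope.
Local Open Scope ring_scope.

(* The library norm on 'rV[R]_n is the sup norm, so the Euclidean structure
   of R^n is introduced here. *)
Definition dotp (R : realType) (n : nat) (u v : 'rV[R]_n) : R :=
  \sum_(i < n) u ord0 i * v ord0 i.

Definition enorm (R : realType) (n : nat) (u : 'rV[R]_n) : R :=
  Num.sqrt (dotp u u).

(* In radians, with values in [0, pi]; meaningful for u, v != 0. *)
Definition angle (R : realType) (n : nat) (u v : 'rV[R]_n) : R :=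
  acos (dotp u v / (enorm u * enorm v)).

Definition contains_angle (R : realType) (n : nat) (A : set 'rV[R]_n)
    (alpha : R) : Prop :=
  exists x y z : 'rV[R]_n,
    [/\ A x, A y & A z] /\ [/\ x != y, x != z & y != z] /\
    angle (y - x) (z - x) = alpha.

(* The diameter of the empty set is -oo here; hgauge treats it separately. *)
Definition ediam (R : realType) (n : nat) (E : set 'rV[R]_n) : \bar R :=
  ereal_sup [set d | exists x y : 'rV[R]_n,
                       [/\ E x, E y & d = (enorm (x - y))%:E]].

(* (diam E)^s, with the usual conventions for s = 0: the value is 0 on the
   empty set and 1 on singletons. *)
Definition hgauge (R : realType) (n : nat) (s : R) (E : set 'rV[R]_n) : \bar R :=
  if `[< E = set0 >] then 0%E else poweR (ediam E) s.

Definition hausdorff_premeasure (R : realType) (n : nat) (s r : R)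
    (A : set 'rV[R]_n) : \bar R :=
  ereal_inf [set h | exists E : nat -> set 'rV[R]_n,
    [/\ A `<=` \bigcup_k E k,
        forall k, (ediam (E k) <= r%:E)%E
      & h = (\sum_(0 <= k <oo) hgauge s (E k))%E]].

Definition hausdorff_measure (R : realType) (n : nat) (s : R)
    (A : set 'rV[R]_n) : \bar R :=
  ereal_sup [set hausdorff_premeasure s r A | r in [set r : R | 0 < r]].

Definition hausdorff_dim (R : realType) (n : nat) (A : set 'rV[R]_n) : \bar R :=
  ereal_inf [set s%:E | s in [set s : R | 0 <= s /\ hausdorff_measure s A = 0%E]].

Definition Ctilde (R : realType) (alpha delta : R) : \bar R :=
  ereal_sup [set d | exists (n : nat) (A : set 'rV[R]_n),
    (forall beta : R, alpha - delta < beta < alpha + delta ->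
       ~ contains_angle A beta) /\
    d = hausdorff_dim A].

(* Main.v *)
(** Suppose the angles of [A] stay away from the right angle, so that
    [|<y-x, z-x>| >= c |y-x| |z-x|] for distinct points of [A], with [c > 0].
    Fix [x] in [A] and let [g y = |x-y|^2].  For [y, z] in [A] with
    [|z-y| <= c |x-y|], the identity [g z - g y = |z-y|^2 - 2 <x-y, z-y>] gives
    [|g z - g y| >= c |x-y| |z-y|].  Hence [A] minus [x] is a countable union of
    pieces on which the real function [g] is injective with Lipschitz inverse,
    and [A] has dimension at most 1.  The line, whose angles are [0] and [pi],
    shows that 1 is attained. *)
Require Import Defs.
From HB Require Import structures.
From mathcomp Require Import all_boot all_order all_algebra.
From mathcomp Require Import all_classical all_reals all_analysis.
From mathcomp Require Import ring lra.
Set Implicit Arguments.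
Unset Strict Implicit.
Unset Printing Implicit Defensive.
Import Order.TTheory GRing.Theory Num.Theory.
Import numFieldNormedType.Exports.
Local Open Scope classical_set_scope.
Local Open Scope ring_scope.

(** * Euclidean norm and inner product on row vectors *)

Section euclidean.
Context {R : realType}.
Implicit Type n : nat.

Lemma dotp_ge0 n (u : 'rV[R]_n) : 0 <= dotp u u.
Proof. by apply: sumr_ge0 => i _; rewrite -expr2 sqr_ge0. Qed.

Lemma enorm_ge0 n (u : 'rV[R]_n) : 0 <= enorm u.
Proof. exact: sqrtr_ge0. Qed.

Lemma sqr_enorm n (u : 'rV[R]_n) : enorm u ^+ 2 = dotp u u.
Proof. by rewrite sqr_sqrtr// dotp_ge0. Qed.

Lemma enorm0 n : enorm (0 : 'rV[R]_n) = 0.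
Proof.
by rewrite /enorm /dotp big1 ?sqrtr0// => i _; rewrite mxE mulr0.
Qed.

Lemma enorm_gt0 n (u : 'rV[R]_n) : u != 0 -> 0 < enorm u.
Proof.
move=> u0; rewrite lt_neqAle enorm_ge0 andbT eq_sym.
apply: contra_neq u0 => e0.
have /eqP := sqr_enorm u; rewrite e0 expr0n /= eq_sym psumr_eq0.
  move=> /allP du; apply/rowP => i; rewrite mxE.
  by have := du i; rewrite mem_index_enum => /(_ isT); rewrite mulf_eq0 orbb => /eqP.
by move=> i _; rewrite -expr2 sqr_ge0.
Qed.

Lemma enorm_rV1 (u : 'rV[R]_1) : enorm u = `|u ord0 ord0|.
Proof. by rewrite /enorm /dotp big_ord1 -expr2 sqrtr_sqr. Qed.

(** The crude factor [n.+1], in place of the square root of [n], stays positive for [n = 0]. *)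
Lemma enorm_le_coord n (u : 'rV[R]_n) (a : R) : 0 <= a ->
  (forall i, `|u ord0 i| <= a) -> enorm u <= n.+1%:R * a.
Proof.
move=> a0 ua; have na0 : 0 <= n.+1%:R * a by rewrite mulr_ge0.
rewrite -[leRHS]ger0_norm// -sqrtr_sqr ler_wsqrtr//.
apply: (@le_trans _ _ (\sum_(i < n) a ^+ 2)).
  apply: ler_sum => i _; rewrite -expr2 -real_normK ?num_real//.
  by rewrite lerXn2r ?nnegrE.
rewrite sumr_const card_ord -(mulr_natl _ n) exprMn ler_wpM2r ?sqr_ge0//.
by rewrite -natrX ler_nat -mulnn mulSn (leq_trans (leqnSn n))// leq_addr.
Qed.

Lemma sqr_enorm_diff n (x y z : 'rV[R]_n) :
  enorm (x - z) ^+ 2 - enorm (x - y) ^+ 2 =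
  enorm (z - y) ^+ 2 - 2 * dotp (x - y) (z - y).
Proof.
rewrite !sqr_enorm /dotp mulr_sumr -!sumrB.
by apply: eq_bigr => i _; rewrite !mxE; ring.
Qed.

End euclidean.

(** * Diameters and gauges of covering sets *)

Section diameter_gauge.
Context {R : realType} {n : nat}.
Implicit Type E : set 'rV[R]_n.

Lemma ediam_le E (d : R) :
  (forall x y, E x -> E y -> enorm (x - y) <= d) -> (ediam E <= d%:E)%E.
Proof.
by move=> Ed; apply: ge_ereal_sup => _ [x [y [Ex Ey ->]]]; rewrite lee_fin Ed.
Qed.

Lemma enorm_le_ediam E x y : E x -> E y -> ((enorm (x - y))%:E <= ediam E)%E.
Proof. by move=> Ex Ey; apply: ereal_sup_ubound; exists x, y. Qed.

Lemma ediam_ge0 E x : E x -> (0 <= ediam E)%E.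
Proof. by move=> Ex; have := enorm_le_ediam Ex Ex; rewrite subrr enorm0. Qed.

Lemma hgauge_ge0 (s : R) E : (0 <= hgauge s E)%E.
Proof. by rewrite /hgauge; case: ifP => // _; exact: poweR_ge0. Qed.

Lemma hgauge_set0 (s : R) : hgauge s (set0 : set 'rV[R]_n) = 0%E.
Proof. by rewrite /hgauge; case: asboolP. Qed.

Lemma hgauge_le (s d : R) E : 0 <= s -> 0 <= d -> (ediam E <= d%:E)%E ->
  (hgauge s E <= (d `^ s)%:E)%E.
Proof.
move=> s0 d0 Ed; rewrite /hgauge; case: asboolP => [_|/eqP/set0P[x Ex]].
  by rewrite lee_fin powR_ge0.
rewrite -poweR_EFin; apply: gt0_ler_poweR => //.
  by rewrite in_itv /= leey (ediam_ge0 Ex).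
by rewrite in_itv /= leey lee_fin d0.
Qed.

End diameter_gauge.

(** Measure zero in terms of explicit covers, the form that passes directly to subsets and countable
    unions. *)
Definition hausdorff_null {R : realType} {n : nat} (s : R) (A : set 'rV[R]_n) :=
  forall r e : R, 0 < r -> 0 < e -> exists E : nat -> set 'rV[R]_n,
    [/\ A `<=` \bigcup_k E k,
        forall k, (ediam (E k) <= r%:E)%E
      & (\sum_(0 <= k <oo) hgauge s (E k) <= e%:E)%E].

(** * Null sets: countable unions and Lipschitz parametrizations *)

Section null_sets.
Context {R : realType} {n : nat}.
Implicit Types A P : set 'rV[R]_n.

Lemma hausdorff_null_measure (s : R) A :
  hausdorff_null s A -> hausdorff_measure s A = 0%E.
Proof.
move=> nA; suff H r : 0 < r -> hausdorff_premeasure s r A = 0%E.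
  apply/eqP; rewrite eq_le; apply/andP; split.
    by apply: ge_ereal_sup => _ [r /= r0 <-]; rewrite H.
  by apply: ereal_sup_ubound; exists 1 => /=; rewrite ?H.
move=> r0; apply/eqP; rewrite eq_le; apply/andP; split.
  apply/lee_addgt0Pr => e e0; rewrite add0e.
  have [E [AE Er Ee]] := nA r e r0 e0.
  by apply: ge_ereal_inf; exists (\sum_(0 <= k <oo) hgauge s (E k))%E => //; exists E.
apply: le_ereal_inf_tmp => _ [E [_ _ ->]].
by apply: nneseries_ge0 => k _ _; exact: hgauge_ge0.
Qed.

Lemma hausdorff_dim_le A (t : R) : 0 <= t ->
  (forall s, t < s -> hausdorff_null s A) -> (hausdorff_dim A <= t%:E)%E.
Proof.
move=> t0 nA; apply/lee_addgt0Pr => e e0.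
apply: ereal_inf_lbound; exists (t + e) => //=; split; first by rewrite addr_ge0// ltW.
by apply/hausdorff_null_measure/nA; rewrite ltrDl.
Qed.

Lemma hausdorff_null_subset (s : R) A P :
  A `<=` P -> hausdorff_null s P -> hausdorff_null s A.
Proof.
move=> AP nP r e r0 e0; have [E [PE Er Ee]] := nP r e r0 e0.
by exists E; split => //; exact: subset_trans AP PE.
Qed.

Lemma hausdorff_null_bigcup (s : R) (P : nat -> set 'rV[R]_n) :
  (forall k, hausdorff_null s (P k)) -> hausdorff_null s (\bigcup_k P k).
Proof.
move=> nP r e r0 e0.
have ek k : 0 < e / (2 ^ k.+1)%:R by rewrite divr_gt0// ltr0n expn_gt0.
have /choice[G PG] := fun k => nP k r _ r0 (ek k).
(* The bijection [f] from [nat] to pairs lists all the covers [G k] as one sequence. *)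
have /card_esym/ppcard_eqP[f] := card_nat2.
exists (fun k => G (f k).1 (f k).2); split.
- move=> y [k _ Pky]; have [PGk _ _] := PG k.
  have [j _ Gkjy] := PGk _ Pky.
  by exists (f^-1%FUN (k, j)) => //; rewrite invK ?inE.
- by move=> k; have [_ + _] := PG (f k).1; exact.
rewrite nneseries_esumT; last by move=> k; exact: hgauge_ge0.
rewrite -(reindex_esum setT setT f (fun k => hgauge s (G k.1 k.2))) //.
have -> : [set: nat * nat] = [set: nat] `*`` (fun=> [set: nat]).
  by apply/seteqP; split.
rewrite -(@esum_esum _ _ _ setT (fun=> setT) (fun i j => hgauge s (G i j))); last first.
  by move=> *; exact: hgauge_ge0.
rewrite -nneseries_esumT; last by move=> k; apply: esum_ge0 => *; exact: hgauge_ge0.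
(* The summand [0] gives the shape of [epsilon_trick], used for the zero sequence. *)
apply: (@le_trans _ _ (\sum_(0 <= i <oo) (0 + (e / (2 ^ i.+1)%:R)%:E))%E).
  apply: lee_nneseries => [i _ _|i _].
    by apply: esum_ge0 => *; exact: hgauge_ge0.
  rewrite -nneseries_esumT; last by move=> k; exact: hgauge_ge0.
  by rewrite add0e; have [] := PG i.
apply: le_trans (epsilon_trick _ _ (ltW e0)) _ => //.
by rewrite eseries0// add0e.
Qed.

(* Slicing [P] along the values of [f] gives about [N * M] pieces of diameter
   [L / N]; as [s > 1] their gauge sum tends to [0] with [N]. *)
Lemma hausdorff_null_lipschitz_inverse (s : R) (f : 'rV[R]_n -> R) (L : R)
    (M : nat) P : 1 < s -> 0 < L ->
  (forall y, P y -> 0 <= f y <= M%:R) ->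
  (forall y z, P y -> P z -> enorm (y - z) <= L * `|f y - f z|) ->
  hausdorff_null s P.
Proof.
move=> s1 L0 fM fL r e r0 e0.
pose K := M.+1%:R * L.
have K0 : 0 < K by rewrite mulr_gt0.
(* Chosen so that [K * t ^ (s - 1) = e]; then [N] makes the mesh [d = L / N] at most both [t] and
   [r]. *)
pose t := (e / K) `^ (s - 1)^-1.
have t0 : 0 < t by rewrite powR_gt0// divr_gt0.
pose N := (Num.truncn (L / t + L / r)).+1.
have N0 : 0 < N%:R :> R by rewrite ltr0n.
have LN : L / t + L / r <= N%:R by exact/ltW/truncnS_gt.
pose d := L / N%:R.
have d0 : 0 < d by rewrite divr_gt0.
have dt : d <= t.
  rewrite ler_pdivrMr// mulrC -ler_pdivrMr//; apply: le_trans LN.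
  by rewrite lerDl ltW// divr_gt0.
have dr : d <= r.
  rewrite ler_pdivrMr// mulrC -ler_pdivrMr//; apply: le_trans LN.
  by rewrite lerDr ltW// divr_gt0.
pose E j : set 'rV[R]_n := P `&` [set y | Num.truncn (N%:R * f y) = j].
(* On one slice the values of [f] differ by less than [1 / N]. *)
have Ed j : (ediam (E j) <= d%:E)%E.
  apply: ediam_le => y z [Py /= yj] [Pz /= zj].
  apply: (le_trans (fL _ _ Py Pz)); rewrite /d ler_wpM2l ?(ltW L0)//.
  have /andP[fy0 _] := fM _ Py; have /andP[fz0 _] := fM _ Pz.
  have := @truncn_itv _ (N%:R * f y) (mulr_ge0 (ltW N0) fy0).
  have := @truncn_itv _ (N%:R * f z) (mulr_ge0 (ltW N0) fz0).
  rewrite yj zj -natr1 => /andP[z1 z2] /andP[y1 y2].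
  rewrite -[leRHS]mul1r ler_pdivlMr// -[X in _ * X]ger0_norm ?(ltW N0)//.
  by rewrite -normrM ler_norml; apply/andP; split; nra.
have E0 j : (N * M < j)%N -> E j = set0.
  move=> Mj; apply/seteqP; split => // y [Py /= yj].
  have /andP[fy0 fy1] := fM _ Py.
  have := @truncn_itv _ (N%:R * f y) (mulr_ge0 (ltW N0) fy0).
  rewrite yj => /andP[y1 _]; have : (N * M)%:R < j%:R :> R by rewrite ltr_nat.
  rewrite natrM ltNge => /negP; apply; apply: (le_trans y1).
  by rewrite ler_wpM2l// ltW.
exists E; split.
- by move=> y Py; exists (Num.truncn (N%:R * f y)).
- by move=> j; apply: le_trans (Ed j) _; rewrite lee_fin.
have s0 : 0 <= s by rewrite (le_trans ler01)// ltW.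
rewrite (nneseries_split 0 (N * M).+1); last by move=> *; exact: hgauge_ge0.
rewrite add0n [X in (_ + X)%E]eseries0 ?adde0; last first.
  by move=> i Ni _; rewrite E0// hgauge_set0.
apply: (@le_trans _ _ (\sum_(0 <= k < (N * M).+1) (d `^ s)%:E)%E).
  by apply: lee_sum => j _; apply: hgauge_le => //; exact: ltW.
rewrite sumEFin lee_fin sumr_const_nat subn0 -mulr_natl.
(* Split [d ^ s = d * d ^ (s - 1)]: the [N * M + 1] slices give [(N * M + 1) * d <= K], and
   [d ^ (s - 1) <= t ^ (s - 1) = e / K]. *)
rewrite -(@mulr_powRB1 _ d s) ?(ltW d0)//; last by rewrite (lt_trans ltr01).
rewrite mulrA; apply: (@le_trans _ _ (K * (e / K))); last first.
  by rewrite mulrC divfK// gt_eqF.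
apply: ler_pM.
- by rewrite mulr_ge0// ltW.
- exact: powR_ge0.
- rewrite /d /K mulrCA mulrC ler_wpM2r ?(ltW L0)// ler_pdivrMr// -natrM ler_nat.
  by rewrite mulSn mulnC addnC -addn1 leq_add2l.
- apply: (@le_trans _ _ (t `^ (s - 1))).
    by apply: ge0_ler_powR; rewrite ?subr_ge0 ?nnegrE// ltW.
  have s1N0 : s - 1 != 0 by rewrite subr_eq0 gt_eqF.
  by rewrite /t -powRrM mulVf// powRr1// divr_ge0// ltW.
Qed.

Lemma hausdorff_null_set1 (s : R) (x : 'rV[R]_n) :
  1 < s -> hausdorff_null s [set x].
Proof.
move=> s1; apply: (@hausdorff_null_lipschitz_inverse s (fun=> 0) 1 0) => //.
  by move=> *; rewrite lexx.
by move=> y z -> ->; rewrite !subrr enorm0 normr0 mulr0.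
Qed.

Lemma hausdorff_null_countable (I : countType) (s : R) (P : I -> set 'rV[R]_n) A :
  1 < s -> (forall i, hausdorff_null s (P i)) ->
  A `<=` \bigcup_i P i -> hausdorff_null s A.
Proof.
move=> s1 nP AP.
(* Numbers that code no index receive a singleton, which is null since [s > 1]. *)
pose Q k := if unpickle k is Some i then P i else [set 0].
apply: (@hausdorff_null_subset s _ (\bigcup_k Q k)).
  by move=> y /AP[i _ Piy]; exists (pickle i) => //; rewrite /Q pickleK.
apply: hausdorff_null_bigcup => k; rewrite /Q.
by case: unpickle => // ; exact: hausdorff_null_set1.
Qed.

End null_sets.

(** * Sets whose angles avoid a neighbourhood of the right angle *)

Section near_right_angles.
Context {R : realType} {n : nat}.
Implicit Types A : set 'rV[R]_n.

(** By continuity of [acos] at 0, a cosine of modulus below [c] would put the angle within [eps] of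
    [acos 0 = pi / 2]. *)
Lemma avoid_right_angle_cos A (eps : R) : 0 < eps ->
  (forall alpha, `|alpha - pi / 2| < eps -> ~ contains_angle A alpha) ->
  exists2 c : R, 0 < c & forall x y z, A x -> A y -> A z ->
    x != y -> x != z -> y != z ->
    c * (enorm (y - x) * enorm (z - x)) <= `|dotp (y - x) (z - x)|.
Proof.
move=> eps0 noA.
have /cvgrPdist_lt/(_ eps eps0) : acos x @[x --> (0 : R)] --> acos (0 : R).
  by apply: continuous_acos; rewrite ltrN10 ltr01.
move=> /nbhs_ballP[c /= c0 cH]; exists c => // x y z Ax Ay Az xy xz yz.
have p0 : 0 < enorm (y - x) * enorm (z - x).
  by rewrite mulr_gt0// enorm_gt0// subr_eq0 eq_sym.
rewrite leNgt; apply/negP => lt_c.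
apply: (noA (angle (y - x) (z - x))); last by exists x, y, z.
rewrite distrC -(acos0 R); apply: cH.
by rewrite /ball /= sub0r normrN normrM normfV (gtr0_norm p0) ltr_pdivrMr.
Qed.

(* Near a point [y] other than [x], the squared distance to [x] changes at a rate
   bounded below along [A], because the angle at [y] stays away from [pi / 2]. *)
Lemma sqr_dist_expands (c : R) (x y z : 'rV[R]_n) : 0 <= c ->
  c * (enorm (x - y) * enorm (z - y)) <= `|dotp (x - y) (z - y)| ->
  enorm (z - y) <= c * enorm (x - y) ->
  c * enorm (x - y) * enorm (z - y) <=
  `|enorm (x - z) ^+ 2 - enorm (x - y) ^+ 2|.
Proof.
move=> c0 cos_ge near; rewrite sqr_enorm_diff.
have zy0 := enorm_ge0 (z - y).
(* The quadratic term thus consumes at most half of the lower bound on twice the inner product. *)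
have h : enorm (z - y) ^+ 2 <= c * enorm (x - y) * enorm (z - y).
  by rewrite expr2 ler_wpM2r.
rewrite distrC; apply: le_trans (lerB_normD _ _).
rewrite normrM ger0_norm// normrN (ger0_norm (sqr_ge0 _)).
rewrite -mulrA in h *; lra.
Qed.

Lemma avoid_right_angle_null A (eps s : R) : 0 < eps -> 1 < s ->
  (forall alpha, `|alpha - pi / 2| < eps -> ~ contains_angle A alpha) ->
  hausdorff_null s A.
Proof.
move=> eps0 s1 /(avoid_right_angle_cos eps0)[c c0 Ac].
have [->|/set0P[x Ax]] := eqVneq A set0.
  apply: (@hausdorff_null_subset _ _ _ _ [set 0]) => //.
  exact: hausdorff_null_set1.
(* Here [m] bounds the distance to [x] above and below, and [v] selects a grid cube of side
   [1 / m.+1]. The cube has diameter at most [n.+1 / m.+1], so any two points of a piece are close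
   enough for [sqr_dist_expands]. The index [None] accounts for [x] itself. *)
pose P (i : option (nat * {ffun 'I_n -> int})) : set 'rV[R]_n :=
  if i is Some (m, v) then
    A `&` [set y | [/\ enorm (x - y) ^+ 2 <= m.+1%:R,
      n.+1%:R / m.+1%:R <= c * enorm (x - y) &
      forall j, Num.floor (m.+1%:R * y ord0 j) = v j]]
  else [set x].
apply: (@hausdorff_null_countable _ _ _ s P) => //; last first.
  move=> y Ay; have [->|xy] := eqVneq y x; first by exists None.
  have xy0 : 0 < c * enorm (x - y).
    by rewrite mulr_gt0// enorm_gt0// subr_eq0 eq_sym.
  pose m := Num.truncn (enorm (x - y) ^+ 2 + n.+1%:R / (c * enorm (x - y))).
  have mH : enorm (x - y) ^+ 2 + n.+1%:R / (c * enorm (x - y)) <= m.+1%:R.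
    exact/ltW/truncnS_gt.
  exists (Some (m, [ffun j => Num.floor (m.+1%:R * y ord0 j)])) => //=.
  split => //; split.
  - by apply: le_trans mH; rewrite lerDl divr_ge0// ltW.
  - rewrite ler_pdivrMr// mulrC -ler_pdivrMr//; apply: le_trans mH.
    by rewrite lerDr sqr_ge0.
  - by move=> j; rewrite ffunE.
case=> [[m v]|]; last exact: hausdorff_null_set1.
(* The inverse has Lipschitz constant [m.+1], because [c * enorm (x - y) >= n.+1 / m.+1 >= 1 / m.+1]
   on the piece. *)
apply: (@hausdorff_null_lipschitz_inverse _ _ _
  (fun y => enorm (x - y) ^+ 2) m.+1%:R m.+1) => //.
  by move=> y [_ [ym _ _]]; rewrite sqr_ge0.
move=> z y [Az [zm zc zv]] [Ay [ym yc yv]].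
have [->|zy] := eqVneq z y; first by rewrite !subrr normr0 mulr0 enorm0.
have m0 : 0 < m.+1%:R :> R by rewrite ltr0n.
have xNy : x != y.
  apply: contraTneq yc => ->; rewrite subrr enorm0 mulr0 -ltNge.
  by rewrite divr_gt0.
have near : enorm (z - y) <= c * enorm (x - y).
  apply: le_trans yc; apply: enorm_le_coord; first by rewrite invr_ge0 ltW.
  move=> j; rewrite !mxE.
  have := floor_itv (m.+1%:R * z ord0 j); have := floor_itv (m.+1%:R * y ord0 j).
  rewrite zv yv intrD => /andP[y1 y2] /andP[z1 z2].
  rewrite -[leRHS]mul1r ler_pdivlMr// -[X in _ * X]gtr0_norm//.
  by rewrite -normrM ler_norml; apply/andP; split; nra.
have yx : y != x by rewrite eq_sym.
have yz : y != z by rewrite eq_sym.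
have xz : x != z.
  apply: contraTneq zc => ->; rewrite subrr enorm0 mulr0 -ltNge.
  by rewrite divr_gt0.
(* The angle bound is applied at the vertex [y], towards [x] and [z]. *)
have := sqr_dist_expands (ltW c0) (Ac _ _ _ Ay Ax Az yx yz xz) near.
move=> H; rewrite mulrC -ler_pdivrMr//; apply: le_trans H.
rewrite mulrC ler_wpM2r ?enorm_ge0//; apply: le_trans yc.
by rewrite -[leLHS]mul1r ler_wpM2r ?ler1n// invr_ge0 ltW.
Qed.

Lemma avoid_right_angle_dim A (eps : R) : 0 < eps ->
  (forall alpha, `|alpha - pi / 2| < eps -> ~ contains_angle A alpha) ->
  (hausdorff_dim A <= 1)%E.
Proof.
move=> eps0 noA; apply: hausdorff_dim_le => // s s1.
exact: avoid_right_angle_null eps0 s1 noA.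
Qed.

End near_right_angles.

(** * The line as extremal example *)

Section line.
Context {R : realType}.

Lemma angle_rV1 (u v : 'rV[R]_1) : u != 0 -> v != 0 ->
  angle u v = 0 \/ angle u v = pi.
Proof.
move=> u0 v0; rewrite /angle.
have p0 : 0 < enorm u * enorm v by rewrite mulr_gt0// enorm_gt0.
have : `|dotp u v / (enorm u * enorm v)| = 1.
  rewrite normrM normfV (gtr0_norm p0) {1}/dotp big_ord1 normrM -!enorm_rV1.
  by rewrite divff// gt_eqF.
case: (ger0P (dotp u v / (enorm u * enorm v))) => _ h.
  by left; rewrite h acos1.
by right; rewrite -[X in acos X]opprK h acosN1.
Qed.

Lemma contains_angle_rV1 (A : set 'rV[R]_1) (alpha : R) :
  contains_angle A alpha -> alpha = 0 \/ alpha = pi.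
Proof.
move=> [x [y [z [_ [[xy xz _] <-]]]]].
by apply: angle_rV1; rewrite subr_eq0 eq_sym.
Qed.

(** For [d] and [s] in [[0, 1]] one has [d <= d ^ s]; the empty set has diameter [-oo]. *)
Lemma ediam_le_hgauge n (s : R) (E : set 'rV[R]_n) : 0 <= s <= 1 ->
  (ediam E <= 1)%E -> (ediam E <= hgauge s E)%E.
Proof.
move=> /andP[s0 s1] E1; rewrite /hgauge.
case: asboolP => [->|/eqP/set0P[x Ex]].
  by apply: ge_ereal_sup => d [y [z []]].
have := ediam_ge0 Ex; move: E1; case: (ediam E) => [d| |]//.
rewrite !lee_fin => d1; rewrite le_eqVlt => /predU1P[<-|d0].
  exact: powR_ge0.
by rewrite ger1_powR// d0.
Qed.

(** Otherwise sets of diameter at most 1 with gauge sum below 1/4 cover the line; enlarged to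
    intervals, they cover [[0, 1]] with total length below 1/2. *)
Lemma hausdorff_measure_line (s : R) : 0 <= s <= 1 ->
  hausdorff_measure s [set: 'rV[R]_1] != 0%E.
Proof.
move=> s01; apply/eqP => Hs.
have : (hausdorff_premeasure s 1 [set: 'rV[R]_1] < (4^-1)%:E)%E.
  apply: (@le_lt_trans _ _ 0%E); last by rewrite lte_fin invr_gt0.
  by rewrite -Hs; apply: ereal_sup_ubound; exists 1 => /=.
move=> /ereal_inf_lt[_ [E [TE E1 ->]]] sumE.
have /choice[F FH] : forall k, exists F : set R, [/\ measurable F,
    (fun t : R => \row_(i < 1) t) @^-1` E k `<=` F &
    (lebesgue_measure F <= 2%:E * hgauge s (E k))%E].
  move=> k; have [E0|/set0P[a Ea]] := eqVneq (E k) set0.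
    exists set0; split => //; first by rewrite E0.
    by rewrite measure0 mule_ge0// hgauge_ge0.
  have dE := ediam_le_hgauge s01 (E1 k).
  have := ediam_ge0 Ea; have := E1 k.
  case dk : (ediam (E k)) => [d| |]// _ d0.
  (* A set of diameter [d] lies in the interval of radius [d] about any of its points; this costs
     the factor 2. *)
  exists `[a ord0 ord0 - d, a ord0 ord0 + d]%classic; split => //.
    move=> t /= Et; have := enorm_le_ediam Et Ea.
    by rewrite dk lee_fin enorm_rV1 !mxE ler_distl in_itv.
  rewrite lebesgue_measure_itv /=; apply: (@le_trans _ _ (2%:E * d%:E)%E).
    case: ifPn => _; last by rewrite mule_ge0.
    by rewrite -EFinB -EFinM lee_fin; lra.
  by rewrite lee_pmul2l// -dk.
have : (lebesgue_measure (`[0%R, 1%R]%classic : set R) <=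
    \sum_(0 <= k <oo) lebesgue_measure (F k))%E.
  apply: measure_sigma_subadditive => //; first by move=> k; have [] := FH k.
  move=> t _; have [k _ Ek] := TE (\row_(i < 1) t) I.
  by exists k => //; have [_ + _] := FH k; exact.
rewrite lebesgue_measure_itv /= lte_fin ltr01 sube0 => H.
have : (1 <= 2%:E * \sum_(0 <= k <oo) hgauge s (E k))%E.
  rewrite -nneseriesZl; last by move=> *; exact: hgauge_ge0.
  apply: (le_trans H); apply: lee_nneseries => // k _.
  by have [] := FH k.
apply/negP; rewrite -ltNge.
apply: (@lt_trans _ _ (2%:E * (4^-1)%:E)%E); first by rewrite lte_pmul2l.
by rewrite -EFinM lte_fin; lra.
Qed.

Lemma hausdorff_dim_line : (1 <= hausdorff_dim [set: 'rV[R]_1])%E.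
Proof.
apply: le_ereal_inf_tmp => _ [s /= [s0 Hs] <-]; rewrite lee_fin leNgt.
apply/negP => s1; have := @hausdorff_measure_line s.
by rewrite s0 ltW// Hs eqxx => /(_ isT).
Qed.

End line.

(** * Angles near the right angle in dimension above 1, and the value of [Ctilde] *)

Theorem theorem4p1 (R : realType) :
  (forall (n : nat) (A : set 'rV[R]_n),
      (2 <= n)%N -> (1 < hausdorff_dim A)%E ->
      forall eps : R, 0 < eps ->
        exists alpha : R, contains_angle A alpha /\ `|alpha - pi / 2| < eps)
  /\
  (forall delta : R, 0 < delta <= pi / 2 ->
      Ctilde (pi / 2) delta = 1%E).
Proof.
split=> [n A _ dimA eps eps0|delta /andP[delta0 deltapi]].
  apply: contrapT => noA; move: dimA; rewrite ltNge => /negP; apply.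
  apply: (avoid_right_angle_dim eps0) => alpha near_alpha Aalpha.
  by apply: noA; exists alpha.
apply/eqP; rewrite eq_le; apply/andP; split.
  apply: ge_ereal_sup => _ [n [A [noA ->]]].
  apply: (avoid_right_angle_dim delta0) => alpha.
  by rewrite ltr_distl => /noA.
apply: le_trans hausdorff_dim_line _; apply: ereal_sup_ubound.
exists 1%N, setT; split => // beta /andP[beta_gt beta_lt].
(* As [delta <= pi / 2], the open interval contains neither 0 nor [pi]. *)
by move=> /contains_angle_rV1[] beta_eq; move: beta_gt beta_lt; rewrite beta_eq; lra.
Qed.
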